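(* For every $n\ge 1$, the sextet polynomial $P_n(x)$ of the pyrene chain $P_n$ has symmetric, unimodal and log-concave coefficients.
   Context: A finite sequence $a_0,a_1,\ldots,a_m$ of nonnegative numbers is symmetric if $a_k=a_{m-k}$ for $0\le k\le m$; log-concave if $a_{k-1}a_{k+1}\le a_k^2$ for $0<k<m$; and unimodal if $a_0\le a_1\le\cdots\le a_j\ge a_{j+1}\ge\cdots\ge a_m$ for some $j$. These are applied to the sequence of coefficients of $P_n(x)$, from degree $0$ to $\deg P_n=2n$. A hexagonal system is a finite connected plane graph without cut vertices in which every interior face is bounded by a regular hexagon of side length $1$; its hexagons are its interior faces. Let $H$ be a hexagonal system with at least one perfect matching (Kekulé structure). A Clar cover of $H$ is a spanning subgraph of $H$ each connected component of which is either a hexagon or an edge. A resonant pattern of $H$ is the set of hexagons of a Clar cover of $H$. The Clar number $C(H)$ is the maximum number of hexagons in a resonant pattern. The sextet polynomial of $H$ is $\sigma(H,x)=\sum_{k=0}^{C(H)}s(H,k)x^k$, where $s(H,k)$ is the number of resonant patterns of $H$ with exactly $k$ hexagons and $s(H,0)=1$. The pyrene chain $P_n$ ($n\ge 1$) is the hexagonal system with $4n$ hexagons consisting of a straight horizontal row of $2n$ hexagons $h_1,\dots,h_{2n}$ of the hexagonal lattice (consecutive ones sharing a vertical edge) together with, for each $i=1,\dots,n$, the lattice hexagon above the row adjacent to both $h_{2i-1}$ and $h_{2i}$ and the lattice hexagon below the row adjacent to both $h_{2i-1}$ and $h_{2i}$. Its sextet polynomial is denoted $P_n(x)=\sigma(P_n,x)$,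 and $P_0(x)=1$ by convention. These polynomials are determined by $P_0(x)=1$, $P_1(x)=x^2+4x+1$ and the known recurrence $P_n(x)=(x^2+4x+1)P_{n-1}(x)-x^2P_{n-2}(x)$ for $n\ge 2$. *)

(* Defs.v *)
From HB Require Import structures.
From mathcomp Require Import all_boot all_order all_algebra.
From mathcomp Require Import finmap.

Set Implicit Arguments.
Unset Strict Implicit.
Unset Printing Implicit Defensive.

Import Order.TTheory GRing.Theory Num.Theory.

Local Open Scope fset_scope.
Local Open Scope ring_scope.

(* The hexagonal lattice, drawn with vertical edges.  The cell (i, j) is the
   regular hexagon of side 1 centred at (sqrt 3 * (i + j / 2), 3 * j / 2); thus
   (i, j) and (i + 1, j) share a vertical edge, and the two cells above (i, j)
   that are adjacent to it are (i - 1, j + 1) and (i, j + 1).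
   Lattice points get "brick wall" coordinates: up to a translation, (x, y) is
   the point of the plane with abscissa x * sqrt 3 / 2 and ordinate
   3 * y / 2 + 1 / 2 if x + y is even, 3 * y / 2 if x + y is odd.  The hexagon
   (i, j) becomes the 2 x 1 brick with lower left corner (2 * i + j, j). *)
Definition cell := (int * int)%type.
Definition point := (int * int)%type.

(* In cyclic order around the boundary. *)
Definition corners (c : cell) : seq point :=
  let x := c.1 *+ 2 + c.2 in let y := c.2 in
  [:: (x, y); (x + 1, y); (x + 2, y);
      (x + 2, y + 1); (x + 1, y + 1); (x, y + 1)].

Definition hexagon_vertices (c : cell) : {fset point} :=
  [fset p in corners c].

Definition hexagon_edges (c : cell) : {fset {fset point}} :=
  [fset [fset p; next (corners c) p] | p in corners c].

(* A hexagonal system is a subgraph of the hexagonal lattice, and it is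
   determined by the set H of its hexagons (its interior faces). *)
Definition vertices (H : {fset cell}) : {fset point} :=
  \bigcup_(c <- H) hexagon_vertices c.

Definition edges (H : {fset cell}) : {fset {fset point}} :=
  \bigcup_(c <- H) hexagon_edges c.

(* Graphs are pairs (vertex set, edge set). *)
Definition graph := ({fset point} * {fset {fset point}})%type.

Definition hexagon_graph (c : cell) : graph :=
  (hexagon_vertices c, hexagon_edges c).

Definition edge_graph (e : {fset point}) : graph := (e, [fset e]).

(* The connected component of v in the graph (V, F). *)
Definition component (V : {fset point}) (F : {fset {fset point}}) (v : V) :
    graph :=
  let C := [fset val w | w : V in
              connect (fun p q : V => [fset val p; val q] \in F) v] in
  (C, [fset e in F | e `<=` C]).

(* A spanning subgraph of H is given by its edge set F. *)
Definition clar_cover (H : {fset cell}) (F : {fset {fset point}}) : bool :=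
  (F `<=` edges H) &&
  [forall v : vertices H,
     [exists c : H, component F v == hexagon_graph (val c)] ||
     [exists e : F, component F v == edge_graph (val e)]].

Definition clar_cover_hexagons (H : {fset cell}) (F : {fset {fset point}}) :
    {fset cell} :=
  [fset c in H | [exists v : vertices H, component F v == hexagon_graph c]].

Definition resonant_patterns (H : {fset cell}) : {fset {fset cell}} :=
  [fset clar_cover_hexagons H F | F in fpowerset (edges H) & clar_cover H F].

Definition clar_number (H : {fset cell}) : nat :=
  \max_(S <- resonant_patterns H) #|` S|.

Definition num_resonant (H : {fset cell}) (k : nat) : nat :=
  #|` [fset S in resonant_patterns H | #|` S| == k]|.

Definition sextet_poly (H : {fset cell}) : {poly nat} :=
  \poly_(k < (clar_number H).+1) num_resonant H k.

(* The row h_1, ..., h_2n consists of the cells (k, 0) for k < 2n, with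
   h_(k+1) = (k, 0); the cells adjacent to both (2i, 0) and (2i + 1, 0) are
   (2i, 1), above the row, and (2i + 1, -1), below it. *)
Definition pyrene_chain (n : nat) : {fset cell} :=
  [fset ((k%:Z, 0) : cell) | k in iota 0 n.*2] `|`
  [fset (((i.*2)%:Z, 1) : cell) | i in iota 0 n] `|`
  [fset (((i.*2.+1)%:Z, - 1) : cell) | i in iota 0 n].

(* For a polynomial p, the sequence polyseq p lists the coefficients of p from
   degree 0 to the degree of p. *)
Definition symmetric_seq (a : seq nat) : Prop :=
  forall k, (k < size a)%N -> nth 0%N a k = nth 0%N a ((size a).-1 - k).

Definition log_concave_seq (a : seq nat) : Prop :=
  forall k, (0 < k)%N -> (k.+1 < size a)%N ->
    (nth 0 a k.-1 * nth 0 a k.+1 <= nth 0 a k ^ 2)%N.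

Definition unimodal_seq (a : seq nat) : Prop :=
  exists2 j, (j < size a)%N &
    (forall k, (k < j)%N -> (nth 0 a k <= nth 0 a k.+1)%N) /\
    (forall k, (j <= k)%N -> (k.+1 < size a)%N ->
       (nth 0 a k.+1 <= nth 0 a k)%N).

(* Main.v *)
Require Import Defs.
From HB Require Import structures.
From mathcomp Require Import all_boot all_order all_algebra all_field.
From mathcomp Require Import finmap zify ring.

(** A resonant pattern is a set of pairwise vertex-disjoint hexagons whose
    uncovered vertices have a perfect matching.  In a pyrene chain the matching
    condition is automatic: for any vertex-disjoint set S of hexagons, an
    explicit involution [partner], which looks only at whether the left row
    hexagon of each pyrene unit belongs to S, pairs every vertex off S with a
    neighbour off S ([independent_resonant_pattern]).  Hence the sextet
    polynomial is the independence polynomial of the graph on the hexagons in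
    which overlapping ones are joined ([sextet_poly_pyrene]), and deleting the
    four hexagons of the last unit one at a time gives
      P_(n+2) = (X^2 + 4 X + 1) P_(n+1) - X^2 P_n   ([pyrene_polySS]).

    This is the recurrence of the Chebyshev polynomials U_n of the second kind,
    rescaled so that U_n(y) has the roots c_k = w^k + w^-k, 0 < k <= n, where w
    is a primitive root of unity of order 2 (n + 1): at every point x <> 0,
    P_n(x) = x^n U_n((x^2 + 4 x + 1) / x).  Therefore
      P_n = prod_k (X^2 + (4 - c_k) X + 1)   ([recurrence_factorization]),
    with 4 - c_k >= 2 because c_k is twice the real part of a number of modulus
    1.  Each factor is palindromic, so P_n is; and each factor splits as
    (X + a)(X + b) with a, b >= 0.  Multiplying by X + a with a >= 0 preserves
    the strong form of log-concavity f_i f_(j+2) <= f_(i+1) f_(j+1), i <= j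
    ([log_concave_poly_mulXaddC]), which passes to P_n.

    Unimodality follows from this strong form and the symmetry: for k < n,
    f_k f_(2n-k) <= f_(k+1) f_(2n-k-1) reads f_k^2 <= f_(k+1)^2. *)

Set Implicit Arguments.
Unset Strict Implicit.
Unset Printing Implicit Defensive.

Import Order.TTheory GRing.Theory Num.Theory.

Local Open Scope fset_scope.
Local Open Scope ring_scope.

(** * Log-concave and palindromic products of quadratics *)

(** Comparing arbitrarily distant indices rules out internal zeros when f is
    nonnegative; the usual definition allows them, and is not stable under
    multiplication by 1 + X. *)
Definition strongly_log_concave (R : numDomainType) (f : nat -> R) : Prop :=
  forall i j, (i <= j)%N -> f i * f j.+2 <= f i.+1 * f j.+1.

(** The coefficients of 1 and a ^+ 2 are compared by the hypothesis directly,
    and the coefficient of a once the common term f (i + 1) * f (j + 2) is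
    removed.  What is left there, f i * f (j + 3) <= f (i + 2) * f (j + 1),
    takes two applications, except that for i = j the first already reaches the goal. *)
Lemma strongly_log_concave_binomial (R : numDomainType) (f : nat -> R) (a : R) :
  0 <= a -> strongly_log_concave f ->
  strongly_log_concave (fun i => f i + a * f i.+1).
Proof.
move=> a0 lcf i j leij.
have cross : f i * f j.+3 <= f i.+2 * f j.+1.
  apply: le_trans (lcf _ _ (leqW leij)) _.
  have [->|neij] := eqVneq i j; first by rewrite mulrC.
  by apply: lcf; rewrite ltn_neqAle neij.
have -> : (f i + a * f i.+1) * (f j.+2 + a * f j.+3) =
  f i * f j.+2 + a ^+ 2 * (f i.+1 * f j.+3) + a * (f i * f j.+3)
  + a * (f i.+1 * f j.+2) by ring.
have -> : (f i.+1 + a * f i.+2) * (f j.+1 + a * f j.+2) =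
  f i.+1 * f j.+1 + a ^+ 2 * (f i.+2 * f j.+2) + a * (f i.+2 * f j.+1)
  + a * (f i.+1 * f j.+2) by ring.
rewrite lerD2r !lerD ?ler_wpM2l ?exprn_ge0 //; exact: lcf.
Qed.

Definition log_concave_poly (R : numDomainType) (p : {poly R}) : Prop :=
  (forall i, 0 <= p`_i) /\ strongly_log_concave (fun i => p`_i).

(** The coefficients of p * ('X + a%:P) are g i + a * g (i + 1) where g is the
    coefficient sequence of p * 'X, which starts with a harmless extra 0. *)
Lemma log_concave_poly_mulXaddC (R : numDomainType) (a : R) (p : {poly R}) :
  0 <= a -> log_concave_poly p -> log_concave_poly (p * ('X + a%:P)).
Proof.
move=> a0 [p0 lcp].
have coefE i : (p * ('X + a%:P))`_i = (p * 'X)`_i + a * (p * 'X)`_i.+1.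
  by rewrite mulrDr coefD coefMC (coefMX _ i.+1) /= [a * _]mulrC.
have pX0 i : 0 <= (p * 'X)`_i by rewrite coefMX; case: ifP.
have lcX : strongly_log_concave (fun i => (p * 'X)`_i).
  move=> [|i] [|j] //= leij; rewrite !coefMX /= ?mul0r ?mulr_ge0 //; exact: lcp.
split=> [i|i j leij]; first by rewrite coefE addr_ge0 // mulr_ge0.
rewrite !coefE; exact: (strongly_log_concave_binomial a0 lcX).
Qed.

(** The degree d is a parameter, and the size only bounded, so that reversal is
    taken in degree d whatever the degree of p. *)
Definition palindromic (R : nzRingType) (d : nat) (p : {poly R}) : Prop :=
  (size p <= d.+1)%N /\ forall i j, (i + j)%N = d -> p`_i = p`_j.

Definition unit_quadratic (R : nzRingType) (d : R) : {poly R} :=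
  'X ^+ 2 + d *: 'X + 1.

Lemma size_unit_quadratic (R : nzRingType) (d : R) :
  size (unit_quadratic d) = 3%N.
Proof.
rewrite /unit_quadratic -addrA size_polyDl size_polyXn //.
rewrite (leq_ltn_trans (size_polyD _ _)) // gtn_max size_poly1 andbT.
by rewrite (leq_ltn_trans (size_scale_leq _ _)) ?size_polyX.
Qed.

Lemma monic_unit_quadratic (R : nzRingType) (d : R) :
  unit_quadratic d \is monic.
Proof.
rewrite monicE lead_coefE size_unit_quadratic /unit_quadratic !coefD coefZ.
by rewrite coefXn coefX coef1 mulr0 !addr0.
Qed.

(** Reversal in degree d + 2 exchanges p * 'X ^+ 2 with p and fixes p * 'X. *)
Lemma palindromic_mul_quadratic (R : comNzRingType) (c : R) d (p : {poly R}) :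
  palindromic d p -> palindromic d.+2 (p * unit_quadratic c).
Proof.
move=> [sp sym]; split.
  apply: leq_trans (size_polyMleq _ _) _; rewrite size_unit_quadratic; lia.
have p0 i : (d < i)%N -> p`_i = 0.
  by move=> lt; rewrite nth_default ?(leq_trans sp).
have low i j : (i + j)%N = d.+2 -> (p * 'X ^+ 2)`_i = p`_j.
  move=> ij; rewrite coefMXn; case: ltnP => i2; first by rewrite p0 //; lia.
  apply: sym; lia.
have mid i j : (i + j)%N = d.+2 -> (p * 'X)`_i = (p * 'X)`_j.
  move=> ij; rewrite !coefMX.
  case: i ij => [|i] ij /=; first by rewrite p0; [case: ifP | lia].
  case: j ij => [|j] ij /=; first by rewrite p0 //; lia.
  apply: sym; lia.
move=> i j ij; rewrite /unit_quadratic !mulrDr !coefD mulr1.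
rewrite -!scalerAr !coefZ (low i j) // -(low j i) ?(mid i j) //; first by ring.
by rewrite addnC.
Qed.

(** For d >= 2 the discriminant d ^+ 2 - 4 is nonnegative, so the quadratic is
    ('X + a)('X + b) with real a, b of sum d and product 1, hence
    nonnegative. *)
Lemma log_concave_mul_quadratic (d : algC) (p : {poly algC}) :
  2 <= d -> log_concave_poly p -> log_concave_poly (p * unit_quadratic d).
Proof.
move=> d2 lcp.
have d0 : 0 <= d by apply: le_trans d2.
have dd : 0 <= d ^+ 2 - 4.
  by rewrite subr_ge0 (_ : 4 = 2 ^+ 2) ?lerXn2r ?nnegrE // -natrX.
pose s := sqrtC (d ^+ 2 - 4); pose a := (d + s) / 2; pose b := (d - s) / 2.
have s0 : 0 <= s by rewrite sqrtC_ge0.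
have ss : s ^+ 2 = d ^+ 2 - 4 by rewrite sqrtCK.
have ab : a + b = d by rewrite /a /b; field.
have ab1 : a * b = 1.
  have -> : a * b = (d ^+ 2 - s ^+ 2) / 4 by rewrite /a /b; field.
  by rewrite ss; field.
have a0 : 0 <= a by rewrite divr_ge0 ?addr_ge0.
have b0 : 0 <= b.
  have an0 : a != 0.
    by apply: contra_eq_neq ab1 => ->; rewrite mul0r eq_sym oner_neq0.
  by rewrite -[b](mulKf an0) ab1 mulr1 invr_ge0.
suff -> : unit_quadratic d = ('X + a%:P) * ('X + b%:P).
  rewrite mulrA; do 2!apply: log_concave_poly_mulXaddC => //.
have ab1P : a%:P * b%:P = 1 by rewrite -polyCM ab1.
by rewrite /unit_quadratic -ab -mul_polyC polyCD -ab1P; ring.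
Qed.

(** * Factoring the recurrence through Chebyshev polynomials *)

(** Chebyshev polynomials of the second kind in the monic normalisation, usually
    written U_n(X / 2). *)
Fixpoint chebyshev (R : nzRingType) (n : nat) : {poly R} :=
  if n isn't m.+1 then 1
  else if m isn't k.+1 then 'X else 'X * chebyshev R m - chebyshev R k.

Lemma pair_ind (P : nat -> Prop) :
  P 0 -> P 1 -> (forall n, P n -> P n.+1 -> P n.+2) -> forall n, P n.
Proof.
move=> P0 P1 PS n; suff: P n /\ P n.+1 by case.
by elim: n => [|n [Pn Pn1]]; split=> //; apply: PS.
Qed.

Lemma chebyshevS (R : nzRingType) n :
  chebyshev R n.+2 = 'X * chebyshev R n.+1 - chebyshev R n.
Proof. by []. Qed.

Lemma chebyshev_monic (R : nzRingType) n :
  chebyshev R n \is monic /\ size (chebyshev R n) = n.+1.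
Proof.
elim/pair_ind: n => [||n [_ sn] [mn1 sn1]]; rewrite ?chebyshevS.
- by rewrite monic1 size_poly1.
- by rewrite monicX size_polyX.
have sX : size ('X * chebyshev R n.+1) = n.+3.
  by rewrite -(commr_polyX (chebyshev R n.+1)) size_mulX ?sn1 // monic_neq0.
have lt : (size (- chebyshev R n)%R < size ('X * chebyshev R n.+1)%R)%N.
  by rewrite size_polyN sX sn.
split; last by rewrite size_polyDl.
by rewrite monicE lead_coefDl // -(commr_polyX (chebyshev R n.+1)) lead_coefMX.
Qed.

(** The analogue of sin t * U_n(cos t) = sin ((n + 1) t), with z for
    exp(i t). *)
Lemma chebyshev_horner (F : fieldType) (z : F) n : z != 0 ->
  (z - z^-1) * (chebyshev F n).[z + z^-1] = z ^+ n.+1 - z ^- n.+1.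
Proof.
move=> z0; elim/pair_ind: n => [||n IH IH1].
- by rewrite hornerC mulr1 !expr1.
- by rewrite hornerX; field.
rewrite chebyshevS !hornerE mulrBr IH mulrCA IH1 -!exprVn.
have zV : z * z^-1 = 1 by rewrite mulfV.
rewrite !(exprS _ n.+2) !(exprS _ n.+1).
set Z := z ^+ n.+1; set W := z^-1 ^+ n.+1; set u := z^-1 in zV *.
have -> : (z + u) * (z * Z - u * W) - (Z - W) =
  z * (z * Z) - u * (u * W) + (z * u - 1) * (Z - W) by ring.
by rewrite zV subrr mul0r addr0.
Qed.

(** By [chebyshev_horner], w ^+ k + w ^- k is a root for each k with
    0 < k <= n when w is a primitive root of unity of order 2 (n + 1).
    These n numbers are distinct, so they are all the roots, and each is twice
    the real part of a number of modulus 1. *)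
Lemma chebyshev_prod n :
  exists2 s : seq algC, size s = n /\ {in s, forall c, c <= 2} &
    chebyshev algC n = \prod_(c <- s) ('X - c%:P).
Proof.
have [w wP] : {w : algC | (n.+1.*2).-primitive_root w}.
  by apply: C_prim_root_exists; rewrite double_gt0.
have w_id k : (w ^+ k == 1) = (n.+1.*2 %| k)%N by rewrite (prim_order_dvd wP).
have w0 : w != 0.
  apply: contra_eq_neq (prim_expr_order wP) => ->.
  by rewrite expr0n /= eq_sym oner_neq0.
have wk0 k : w ^+ k != 0 by rewrite expf_neq0.
have normw k : `|w ^+ k| = 1.
  have /eqP := congr1 Num.norm (prim_expr_order wP).
  rewrite normrX normr1 pexpr_eq1 ?double_gt0 // => /eqP w1.
  by rewrite normrX w1 expr1n.
pose c k := w ^+ k + w ^- k.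
exists [seq c k | k <- iota 1 n].
  split; first by rewrite size_map size_iota.
  move=> _ /mapP[k _ ->].
  rewrite /c (invC_norm (w ^+ k)) normw expr1n invr1 mul1r.
  have := leif_Re_Creal (w ^+ k); rewrite normw ReE => -[le1 _].
  by move: le1; rewrite ler_pdivrMr // mul1r.
rewrite {1}[chebyshev _ n](@all_roots_prod_XsubC _ _ [seq c k | k <- iota 1 n]).
- have [/monicP-> _] := chebyshev_monic algC n.
  by rewrite scale1r.
- by rewrite size_map size_iota; case: (chebyshev_monic algC n).
- apply/allP => _ /mapP[k kn ->]; move: kn; rewrite mem_iota rootE => kn.
  have : (w ^+ k - w ^- k) * (chebyshev algC n).[c k] == 0.
    rewrite chebyshev_horner //; set y := w ^+ k ^+ n.+1.
    have y0 : y != 0 by rewrite expf_neq0.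
    rewrite subr_eq0 -(inj_eq (mulfI y0)) mulfV // /y -exprD -exprM w_id.
    by rewrite addnn dvdn_mull.
  rewrite mulf_eq0 => /orP[|//].
  rewrite subr_eq0 -(inj_eq (mulfI (wk0 k))) mulfV // -exprD w_id addnn.
  by rewrite -!muln2 dvdn_pmul2r // => /dvdn_leq; lia.
- rewrite uniq_rootsE map_inj_in_uniq ?iota_uniq //.
  move=> j k; rewrite !mem_iota => jn kn cjk.
  have : (w ^+ j - w ^+ k) * (w ^+ (j + k) - 1) == 0.
    have -> : (w ^+ j - w ^+ k) * (w ^+ (j + k) - 1) =
      w ^+ (j + k) * (c j - c k).
      rewrite exprD /c; field; by rewrite !wk0.
    by rewrite cjk subrr mulr0.
  rewrite mulf_eq0 !subr_eq0 w_id (eq_prim_root_expr wP) => /orP[].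
    by rewrite !modn_small; [move/eqP | lia | lia].
  by move/dvdn_leq; lia.
Qed.

(** Solutions of the recurrence are homogenised Chebyshev polynomials. *)
Lemma homogeneous_chebyshev_horner (F : fieldType) (a b : F)
    (p : nat -> F) : b != 0 ->
  p 0%N = 1 -> p 1%N = a -> (forall n, p n.+2 = a * p n.+1 - b ^+ 2 * p n) ->
  forall n, p n = b ^+ n * (chebyshev F n).[a / b].
Proof.
move=> b0 p0 p1 pS; elim/pair_ind => [||n IH IH1].
- by rewrite p0 hornerC mulr1.
- by rewrite p1 hornerX; field.
rewrite pS IH IH1 chebyshevS hornerD hornerN hornerM hornerX !exprS; field.
by rewrite b0.
Qed.

(** The point 0 is left out because the homogenisation divides by it. *)
Lemma eq_poly_nonzero (p q : {poly algC}) :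
  (forall x, x != 0 -> p.[x] = q.[x]) -> p = q.
Proof.
move=> pq; apply/eqP; rewrite -subr_eq0.
pose s := [seq (k.+1)%:R : algC | k <- iota 0 (size (p - q))].
apply/eqP/(@roots_geq_poly_eq0 _ _ s).
- apply/allP => _ /mapP[k _ ->].
  by rewrite rootE hornerD hornerN pq ?subrr // pnatr_eq0.
- rewrite map_inj_uniq ?iota_uniq // => j k /eqP.
  by rewrite eqr_nat => /eqP[].
- by rewrite size_map size_iota.
Qed.

(** Homogenising the factor 'X - c of a Chebyshev polynomial at
    (x ^+ 2 + 4 * x + 1) / x gives x ^+ 2 + (4 - c) * x + 1. *)
Lemma recurrence_factorization (p : nat -> {poly algC}) :
  p 0%N = 1 -> p 1%N = unit_quadratic 4 ->
  (forall n, p n.+2 = unit_quadratic 4 * p n.+1 - 'X ^+ 2 * p n) ->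
  forall n, exists2 s : seq algC, size s = n /\ {in s, forall d, 2 <= d} &
    p n = \prod_(d <- s) unit_quadratic d.
Proof.
move=> p0 p1 pS n; have [s [sn s2] sE] := chebyshev_prod n.
exists [seq 4 - c | c <- s].
  split; first by rewrite size_map.
  move=> _ /mapP[c cs ->]; rewrite lerBrDr -lerBrDl.
  apply: le_trans (s2 _ cs) _.
  by rewrite lerBrDr -natrD.
apply: eq_poly_nonzero => x x0.
pose a := (unit_quadratic (4 : algC)).[x].
rewrite (@homogeneous_chebyshev_horner _ a x (fun k => (p k).[x])) //.
- rewrite sE -sn big_map !horner_prod; elim: (s) => [|c r IH] /=.
    by rewrite !big_nil mulr1.
  rewrite !big_cons exprS mulrACA IH; congr (_ * _).
  by rewrite /a /unit_quadratic !hornerE; field.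
- by rewrite p0 hornerC.
- by rewrite p1.
- by move=> k; rewrite pS hornerD hornerN !hornerM hornerX.
Qed.

Lemma unit_quadratic_prod (s : seq algC) :
  {in s, forall d, 2 <= d} ->
  let p := \prod_(d <- s) unit_quadratic d in
  [/\ p \is monic, size p = (size s).*2.+1, palindromic (size s).*2 p &
      log_concave_poly p].
Proof.
elim: s => [_|d s IH s2] /=.
  rewrite big_nil; split; rewrite ?monic1 ?size_poly1 //.
    by split=> [|[|i] [|j]]; rewrite ?size_poly1.
  split=> [i|[|i] j _]; rewrite !coef1 ?mulr0 ?mul0r //; by case: (i).
have [|mp sp pal lc] := IH; first by move=> c cs; apply: s2; rewrite inE cs orbT.
have d2 : 2 <= d by apply: s2; rewrite mem_head.
rewrite big_cons mulrC; split.
- by rewrite monicMl // monic_unit_quadratic.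
- rewrite size_Mmonic ?monic_unit_quadratic ?monic_neq0 // sp.
  by rewrite size_unit_quadratic; lia.
- exact: palindromic_mul_quadratic.
- exact: log_concave_mul_quadratic.
Qed.

(** * Components and resonant patterns *)

(** In brick wall coordinates a hexagon is a 2 x 1 rectangle, so membership is a
    conjunction of linear inequalities. *)
Lemma in_corners (c : cell) (p : point) :
  (p \in corners c) =
  (c.1 * 2 + c.2 <= p.1 <= c.1 * 2 + c.2 + 2) && (c.2 <= p.2 <= c.2 + 1).
Proof.
case: c p => i j [x y]; rewrite !inE !xpair_eqE /= mulr2n; lia.
Qed.

Lemma uniq_corners (c : cell) : uniq (corners c).
Proof.
case: c => i j; rewrite /= !inE !xpair_eqE /= mulr2n; lia.
Qed.

Lemma hexagon_verticesE (c : cell) (p : point) :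
  (p \in hexagon_vertices c) = (p \in corners c).
Proof. by rewrite in_fset. Qed.

Lemma in_bigfcupP (I T : choiceType) (f : I -> {fset T}) (A : {fset I}) (x : T) :
  reflect (exists2 i, i \in A & x \in f i) (x \in \bigcup_(i <- A) f i).
Proof.
apply: (iffP (bigfcupP _ _ _ _)) => [[i /andP[]]|[i]]; first by exists i.
by exists i => //; apply/andP.
Qed.

Lemma verticesP (H : {fset cell}) (p : point) :
  reflect (exists2 c, c \in H & p \in corners c) (p \in vertices H).
Proof.
by apply: (iffP (in_bigfcupP _ _ _)) => -[c cH pc]; exists c => //;
  move: pc; rewrite hexagon_verticesE.
Qed.

Lemma edgesP (H : {fset cell}) e :
  reflect (exists2 c, c \in H & e \in hexagon_edges c) (e \in edges H).
Proof. exact: in_bigfcupP. Qed.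

Lemma hexagon_edgesP (c : cell) e :
  reflect (exists2 p, p \in corners c & e = [fset p; next (corners c) p])
          (e \in hexagon_edges c).
Proof. exact: imfsetP. Qed.

Lemma hexagon_edge_nth (c : cell) k : (k < 6)%N ->
  [fset nth (0, 0) (corners c) k; nth (0, 0) (corners c) (k.+1 %% 6)]
    \in hexagon_edges c.
Proof.
move=> k6; apply/hexagon_edgesP; exists (nth (0, 0) (corners c) k).
  exact: mem_nth.
congr [fset _; _]; rewrite next_nth mem_nth // index_uniq ?uniq_corners //.
by case: k k6 => [|[|[|[|[|[|]]]]]].
Qed.

Lemma hexagon_vertices_inj : injective hexagon_vertices.
Proof.
move=> [i j] [i' j'] /fsetP eqV.
have := eqV (i * 2 + j, j); have := eqV (i * 2 + j + 2, j + 1).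
rewrite !hexagon_verticesE !in_corners /= => e1 e2.
by congr (_, _); lia.
Qed.

Section Component.

Variables (V : {fset point}) (F : {fset {fset point}}).
Let adj : rel V := fun p q => [fset val p; val q] \in F.

Lemma component_vertexP (v : V) (w : point) :
  reflect (exists2 u : V, connect adj v u & w = val u)
          (w \in (component F v).1).
Proof.
rewrite /component /=; apply: (iffP (imfsetP _ _ _ _)) => -[u uv ->];
  by exists u.
Qed.

Lemma component_edges (v : V) :
  (component F v).2 = [fset e in F | e `<=` (component F v).1].
Proof. by []. Qed.

Lemma connect_adj_sym : connect_sym adj.
Proof. by apply: sym_connect_sym => p q; rewrite /adj fsetUC. Qed.

Lemma component_connect (v w : V) : connect adj v w ->
  component F v = component F w.
Proof.
move=> vw; have eqC : (component F v).1 = (component F w).1.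
  apply/fsetP => x; apply/component_vertexP/component_vertexP => -[u xu ->];
    exists u => //; by rewrite ?(same_connect connect_adj_sym vw) //
      -(same_connect connect_adj_sym vw).
rewrite [LHS]surjective_pairing [RHS]surjective_pairing; congr (_, _) => //.
by rewrite !component_edges eqC.
Qed.

(** A connected set of vertices that no edge leaves is a component. *)
Lemma component_eq (v : V) (C : {fset point}) :
  val v \in C ->
  (forall p q, p \in C -> [fset p; q] \in F -> q \in C) ->
  (forall w : V, val w \in C -> connect adj v w) ->
  C `<=` V ->
  component F v = (C, [fset e in F | e `<=` C]).
Proof.
move=> vC closedC connC CV.
have eqC : (component F v).1 = C.
  apply/fsetP => x; apply/component_vertexP/idP => [[u vu ->]|xC].
    have clC : closed adj [pred p : V | val p \in C].
      apply: intro_closed; first exact: connect_adj_sym.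
      by move=> p q pq pC; apply: closedC pC pq.
    by have := closed_connect clC vu; rewrite !inE vC => <-.
  have xV := fsubsetP CV _ xC.
  by exists [` xV] => //; apply: connC.
by rewrite [LHS]surjective_pairing eqC; congr (_, _); rewrite component_edges eqC.
Qed.

End Component.

Definition vertex_disjoint (S : {fset cell}) : Prop :=
  forall c d p, c \in S -> d \in S -> p \in corners c -> p \in corners d ->
  c = d.

Lemma clar_cover_hexagonsP (H : {fset cell}) F (c : cell) :
  reflect (c \in H /\ exists v : vertices H, component F v = hexagon_graph c)
          (c \in clar_cover_hexagons H F).
Proof.
rewrite /clar_cover_hexagons in_fset inE /=.
apply: (iffP andP) => -[cH vc]; split=> //.
  by case/existsP: vc => v /eqP; exists v.
by case: vc => v /eqP vc; apply/existsP; exists v.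
Qed.

(** Two hexagons of a Clar cover with a common vertex are both its component. *)
Lemma resonant_pattern_disjoint (H S : {fset cell}) :
  S \in resonant_patterns H -> S `<=` H /\ vertex_disjoint S.
Proof.
case/imfsetP=> F _ ->; split.
  by apply/fsubsetP => c /clar_cover_hexagonsP[].
move=> c d p /clar_cover_hexagonsP[_ [v vc]] /clar_cover_hexagonsP[_ [w wd]] pc pd.
apply: hexagon_vertices_inj.
have : p \in (component F v).1 by rewrite vc hexagon_verticesE.
have : p \in (component F w).1 by rewrite wd hexagon_verticesE.
case/component_vertexP => u wu ->; case/component_vertexP => u' vu' /val_inj eu.
move: vu'; rewrite -eu => vu.
have := component_connect vu; rewrite vc -(component_connect wu) wd.
by case.
Qed.

(** A matching of the vertices off a disjoint set S of hexagons is given by its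
    partner function m.  Its edges, together with the edges of the hexagons of
    S, form a Clar cover. *)
Section Extension.

Variables (H S : {fset cell}) (m : point -> point).
Hypothesis SH : S `<=` H.
Hypothesis disjS : vertex_disjoint S.
Hypothesis matching : forall p, p \in vertices H `\` vertices S ->
  [/\ m p \in vertices H `\` vertices S, m (m p) = p &
      [fset p; m p] \in edges H].

Let F := edges S `|` [fset [fset p; m p] | p in vertices H `\` vertices S].

Lemma extension_edgeP e :
  reflect ((exists2 c, c \in S & e \in hexagon_edges c) \/
           (exists2 p, p \in vertices H `\` vertices S & e = [fset p; m p]))
          (e \in F).
Proof.
rewrite in_fsetU; apply: (iffP orP).
  by case=> [/edgesP|/imfsetP]; [left|right].
by case=> [/edgesP|/imfsetP]; [left|right].
Qed.

Lemma vertices_mono : vertices S `<=` vertices H.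
Proof.
apply/fsubsetP => p /verticesP[c cS pc]; apply/verticesP; exists c => //.
exact: (fsubsetP SH).
Qed.

(** No edge of F leaves a hexagon of S: another hexagon of S is disjoint from
    it, and both ends of a matching edge are uncovered. *)
Lemma extension_edge_covered e c p : c \in S -> p \in corners c -> p \in e ->
  e \in F -> e \in hexagon_edges c.
Proof.
move=> cS pc pe /extension_edgeP[[d dS ed]|[q qU eq]].
  suff -> : c = d by [].
  apply: (disjS cS dS pc).
  case/hexagon_edgesP: ed => q qd eq; move: pe; rewrite eq !in_fset2.
  by case/orP=> /eqP -> //; rewrite mem_next.
have pS : p \in vertices S by apply/verticesP; exists c.
have [mqU _ _] := matching qU.
by move: pe qU mqU; rewrite eq !in_fset2 => /orP[] /eqP <-;
  rewrite [p \in _ `\` _]in_fsetD pS.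
Qed.

Lemma extension_component_hexagon c (v : vertices H) :
  c \in S -> val v \in corners c -> component F v = hexagon_graph c.
Proof.
move=> cS vc.
have cV p : p \in corners c -> p \in vertices H.
  by move=> pc; apply: (fsubsetP vertices_mono); apply/verticesP; exists c.
rewrite (@component_eq _ _ _ (hexagon_vertices c)).
- congr (_, _); apply/fsetP => e; apply/idP/idP; last first.
    move=> ec; rewrite in_fset inE /=; apply/andP; split.
      by apply/extension_edgeP; left; exists c.
    apply/fsubsetP => q; case/hexagon_edgesP: ec => p pc ->.
    by rewrite in_fset2 hexagon_verticesE => /orP[] /eqP ->; rewrite ?mem_next.
  rewrite in_fset inE /= => /andP[eF ec].
  have [p pe] : exists p, p \in e.
    case/extension_edgeP: (eF) => [[d _ /hexagon_edgesP[p _ ->]]|[p _ ->]];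
      by exists p; rewrite !in_fset2 eqxx.
  apply: (@extension_edge_covered _ c p) => //.
  by rewrite -hexagon_verticesE (fsubsetP ec).
- by rewrite hexagon_verticesE.
- move=> p q; rewrite !hexagon_verticesE => pc pqF.
  have /hexagon_edgesP[r rc eqr] : [fset p; q] \in hexagon_edges c.
    by apply: (extension_edge_covered cS pc) => //; rewrite !in_fset2 eqxx.
  have : q \in [fset p; q] by rewrite !in_fset2 eqxx orbT.
  by rewrite eqr !in_fset2 => /orP[] /eqP ->; rewrite ?mem_next.
- set adj := (fun p q : vertices H => _).
  (* Consecutive corners are adjacent, so walking around the boundary connects
     the first corner to all the others. *)
  have from0 k (w u : vertices H) : (k < 6)%N ->
      val w = nth (0, 0) (corners c) 0 -> val u = nth (0, 0) (corners c) k ->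
      connect adj w u.
    elim: k u => [|k IH] u k6 w0 uk.
      by rewrite (_ : u = w) ?connect0 //; apply: val_inj; rewrite uk.
    have pV : nth (0, 0) (corners c) k \in vertices H.
      by apply/cV/mem_nth/ltnW.
    apply: connect_trans (IH [` pV] (ltnW k6) w0 _) _ => //.
    apply: connect1; apply/extension_edgeP; left; exists c => //.
    by have := hexagon_edge_nth c (ltnW k6); rewrite modn_small // -uk.
  have o0 : nth (0, 0) (corners c) 0 \in vertices H by apply/cV/mem_nth.
  have to0 (u : vertices H) : val u \in corners c -> connect adj [` o0] u.
    move=> uc; apply: (from0 (index (val u) (corners c))) => //.
      by have := uc; rewrite -index_mem.
    by rewrite nth_index.
  move=> w; rewrite hexagon_verticesE => wc.
  apply: connect_trans (to0 _ wc).
  by rewrite connect_adj_sym; apply: to0.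
- by apply/fsubsetP => p; rewrite hexagon_verticesE => /cV.
Qed.

Lemma extension_component_edge (v : vertices H) :
  val v \notin vertices S ->
  component F v = edge_graph [fset val v; m (val v)] /\
  [fset val v; m (val v)] \in F.
Proof.
move=> vS; have vU : val v \in vertices H `\` vertices S.
  by rewrite in_fsetD vS; apply: valP.
have eF : [fset val v; m (val v)] \in F.
  by apply/extension_edgeP; right; exists (val v).
have [mU mm _] := matching vU.
have edgeU e p : e \in F -> p \in e -> p \in [fset val v; m (val v)] ->
    e = [fset val v; m (val v)].
  move=> /extension_edgeP[[c cS /hexagon_edgesP[q qc ->]]|[q qU ->]] pe pv.
    have pS : p \in vertices S.
      apply/verticesP; exists c => //; move: pe; rewrite !in_fset2.
      by case/orP => /eqP ->; rewrite ?mem_next.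
    move: pv mU; rewrite !in_fset2 => /orP[] /eqP pE.
      by rewrite -pE pS in vS.
    by rewrite -pE in_fsetD pS.
  have [_ mmq _] := matching qU.
  move: pe pv; rewrite !in_fset2 => /orP[] /eqP -> /orP[] /eqP.
  - by move->.
  - by move->; rewrite mm fsetUC.
  - by move=> mq; rewrite -mq mmq fsetUC.
  - by move/(congr1 m); rewrite mmq mm => ->.
split=> //.
rewrite (@component_eq _ _ _ [fset val v; m (val v)]).
- congr (_, _); apply/fsetP => e; rewrite in_fset1 in_fset inE /=.
  apply/andP/eqP => [[eF' ev]|-> //].
  have [p pe] : exists p, p \in e.
    case/extension_edgeP: (eF') => [[d _ /hexagon_edgesP[p _ ->]]|[p _ ->]];
      by exists p; rewrite !in_fset2 eqxx.
  exact: (edgeU e p eF' pe (fsubsetP ev _ pe)).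
- by rewrite !in_fset2 eqxx.
- move=> p q pv pqF; rewrite -(edgeU _ p pqF) //; by rewrite !in_fset2 eqxx ?orbT.
- move=> w; rewrite !in_fset2 => /orP[/eqP/val_inj ->|/eqP wE]; first exact: connect0.
  by apply: connect1; rewrite wE.
- apply/fsubsetP => p; rewrite !in_fset2 => /orP[] /eqP -> //; first exact: valP.
  by move: mU; rewrite in_fsetD => /andP[].
Qed.

Lemma extension_sub : F `<=` edges H.
Proof.
apply/fsubsetP => e /extension_edgeP[[c cS ec]|[p pU ->]].
  by apply/edgesP; exists c => //; apply: (fsubsetP SH).
by case: (matching pU).
Qed.

Lemma disjoint_resonant_pattern : S \in resonant_patterns H.
Proof.
apply/imfsetP; exists F => /=.
  rewrite inE fpowersetE extension_sub /clar_cover extension_sub /=.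
  apply/forallP => v; apply/orP.
  have [vS|vS] := boolP (val v \in vertices S).
    left; case/verticesP: vS => c cS vc.
    apply/existsP; exists [` fsubsetP SH _ cS].
    by rewrite (extension_component_hexagon cS vc).
  right; have [cE eF] := extension_component_edge vS.
  by apply/existsP; exists [` eF]; rewrite cE.
apply/fsetP => c; apply/idP/clar_cover_hexagonsP => [cS|[cH [v vc]]].
  split; first exact: (fsubsetP SH).
  have oV : nth (0, 0) (corners c) 0 \in vertices H.
    by apply: (fsubsetP vertices_mono); apply/verticesP; exists c => //; apply: mem_nth.
  exists [` oV]; rewrite (extension_component_hexagon cS) //.
  exact: mem_nth.
have [vS|vS] := boolP (val v \in vertices S).
  case/verticesP: vS => d dS vd.
  have := extension_component_hexagon dS vd; rewrite vc => -[/hexagon_vertices_inj].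
  by move->.
have [] := extension_component_edge vS; rewrite vc => -[/fsetP eqV _] _.
(* The vertex set of an edge cannot be that of a hexagon: it would contain
   three distinct corners. *)
have c012 k : (k < 6)%N -> (nth (0, 0) (corners c) k == val v) ||
   (nth (0, 0) (corners c) k == m (val v)).
  by move=> k6; have := eqV (nth (0, 0) (corners c) k);
    rewrite hexagon_verticesE mem_nth // !in_fset2 => <-.
have dist i j : (i < 6)%N -> (j < 6)%N -> i != j ->
    nth (0, 0) (corners c) i <> nth (0, 0) (corners c) j.
  by move=> i6 j6 /eqP nij /eqP; rewrite nth_uniq ?uniq_corners // => /eqP.
have := dist 0%N 1%N isT isT isT; have := dist 0%N 2%N isT isT isT.
have := dist 1%N 2%N isT isT isT.
by case/orP: (c012 0%N isT) => /eqP->; case/orP: (c012 1%N isT) => /eqP->;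
  case/orP: (c012 2%N isT) => /eqP->.
Qed.

End Extension.

(** * Independence polynomials *)

Section Independence.

Variables (T : choiceType) (e : rel T) (R : comNzRingType).

Definition independent (S : {fset T}) : bool :=
  all (fun c => all (fun d => (c == d) || ~~ e c d) S) S.

Lemma independentP (S : {fset T}) :
  reflect (forall c d, c \in S -> d \in S -> e c d -> c = d) (independent S).
Proof.
apply: (iffP allP) => [indS c d cS dS ecd|indS c cS].
  by have /allP/(_ d dS) := indS c cS; rewrite ecd orbF => /eqP.
apply/allP => d dS; rewrite orbC -implybE; apply/implyP => ecd.
by rewrite (indS c d).
Qed.

Definition independence_poly (H : {fset T}) : {poly R} :=
  \sum_(S <- fpowerset H | independent S) 'X^#|` S|.

Lemma independence_poly0 : independence_poly fset0 = 1.
Proof.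
rewrite /independence_poly fpowerset0 big_mkcond big_seq_fset1 cardfs0.
by case: independentP => // -[].
Qed.

Hypothesis e_sym : symmetric e.

(** An independent set avoids c, or it consists of c and an independent set of
    elements of H not related to c. *)
Lemma independence_poly_delete (c : T) (H : {fset T}) : c \notin H ->
  independence_poly (c |` H) =
  independence_poly H + 'X * independence_poly [fset d in H | ~~ e c d].
Proof.
move=> cH; rewrite /independence_poly.
rewrite (big_fsetIDcond _ (fun S : {fset T} => c \notin S)) /=; congr (_ + _).
  apply: eq_fbigl_cond => S; rewrite !inE /= !fpowersetE; congr (_ && _).
  apply/andP/idP => [[SH cS]|SH].
    apply/fsubsetP => d dS; have := fsubsetP SH d dS; rewrite in_fset1U.
    by case/orP => // /eqP dc; rewrite -dc dS in cS.
  split; first by apply: fsubset_trans SH (fsubsetU1 _ _).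
  by apply: contra cH; apply: (fsubsetP SH).
set N := [fset d in H | _].
have cN : c \notin N by rewrite !inE (negPf cH).
rewrite big_fset_condE mulr_sumr [in RHS]big_fset_condE.
pose A := [fset S in fpowerset N | independent S].
transitivity (\sum_(S <- [fset c |` S | S in A]) ('X^#|` S| : {poly R})).
  apply: eq_fbigl => S; apply/idP/imfsetP => /=.
    rewrite !inE !fpowersetE negbK => /andP[/andP[SH cS] /independentP indS].
    exists (S `\ c); last by rewrite fsetD1K.
    rewrite !inE fpowersetE; apply/andP; split.
      apply/fsubsetP => d; rewrite !inE => /andP[dc dS].
      have := fsubsetP SH d dS; rewrite in_fset1U (negPf dc) /= => ->.
      by apply: contra dc => ecd; rewrite (indS c d).
    apply/independentP => d d'; rewrite !inE => /andP[_ dS] /andP[_ dS'].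
    exact: indS.
  case=> S0; rewrite !inE fpowersetE => /andP[SN /independentP indS] ->.
  rewrite !inE negbK eqxx fpowersetE /= andbT; apply/andP; split.
    apply: fsetUS; apply: fsubset_trans SN _.
    by apply/fsubsetP => d; rewrite !inE => /andP[].
  apply/independentP => d d'; rewrite !in_fset1U.
  have noe x : x \in S0 -> e c x = false.
    by move/(fsubsetP SN); rewrite !inE => /andP[_ /negPf].
  case/orP=> [/eqP->|dS] /orP[/eqP->|dS'] //; first by rewrite noe.
    by rewrite e_sym noe.
  exact: indS.
rewrite big_imfset /=; last first.
  move=> S S'; rewrite !inE !fpowersetE => /andP[SN _] /andP[SN' _] eqS.
  have nc X : X `<=` N -> c \notin X by move=> XN; apply: contra cN;
    apply: (fsubsetP XN).
  by rewrite -(fsetU1K (nc _ SN)) eqS fsetU1K ?nc.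
rewrite -/A big_seq [in RHS]big_seq; apply: eq_bigr => S.
rewrite !inE fpowersetE => /andP[SN _].
have cS : c \notin S by apply: contra cN; apply: (fsubsetP SN).
by rewrite cardfsU1 cS exprS.
Qed.

End Independence.

Lemma in_fset_sep (T : choiceType) (A : {fset T}) (P : pred T) (x : T) :
  (x \in [fset y in A | P y]) = (x \in A) && P x.
Proof. by rewrite in_fset inE. Qed.

(** * The overlap graph of a pyrene chain *)

(** The bricks of c and d meet exactly when the lower left corners differ by at
    most 2 horizontally and at most 1 vertically. *)
Definition overlap (c d : cell) : bool :=
  (-2 <= (c.1 - d.1) * 2 + (c.2 - d.2) <= 2) && (-1 <= c.2 - d.2 <= 1).

Lemma overlapP (c d : cell) :
  reflect (exists2 p, p \in corners c & p \in corners d) (overlap c d).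
Proof.
case: c d => i j [i' j']; apply: (iffP idP) => [|[[x y]]].
  rewrite /overlap /= => ov.
  exists (if i * 2 + j <= i' * 2 + j' then i' * 2 + j' else i * 2 + j,
          if j <= j' then j' else j);
    rewrite in_corners /=; do 2!case: ifP; lia.
rewrite !in_corners /overlap /=; lia.
Qed.

Lemma overlap_sym : symmetric overlap.
Proof. by move=> [i j] [i' j']; rewrite /overlap /=; lia. Qed.

Lemma independent_disjoint (S : {fset cell}) :
  reflect (vertex_disjoint S) (independent overlap S).
Proof.
apply: (iffP (independentP _ _)) => disj c d.
  by move=> p cS dS pc pd; apply: disj => //; apply/overlapP; exists p.
by move=> cS dS /overlapP[p pc pd]; apply: (disj _ _ p).
Qed.

Lemma in_pyrene_chain (n : nat) (c : cell) :
  (c \in pyrene_chain n) =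
  (0 <= c.1 < n.*2%:Z) &&
  [|| c.2 == 0, (c.2 == 1) && ((c.1 %% 2)%Z == 0)
    | (c.2 == -1) && ((c.1 %% 2)%Z == 1)].
Proof.
case: c => i j; rewrite /pyrene_chain !in_fsetU /=.
apply/orP/idP => [[/orP[]|]|].
- case/imfsetP => k /=; rewrite mem_iota => kn [-> ->]; lia.
- case/imfsetP => k /=; rewrite mem_iota => kn [-> ->]; lia.
- case/imfsetP => k /=; rewrite mem_iota => kn [-> ->]; lia.
move=> /andP[i0n /or3P[/eqP ->|/andP[/eqP -> i2]|/andP[/eqP -> i2]]].
- left; apply/orP; left; apply/imfsetP; exists `|i|%N.
    by rewrite /= mem_iota; lia.
  by congr (_, _); lia.
- left; apply/orP; right; apply/imfsetP; exists (`|i|./2)%N.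
    by rewrite /= mem_iota; lia.
  by congr (_, _); lia.
- right; apply/imfsetP; exists (`|i|./2)%N.
    by rewrite /= mem_iota; lia.
  by congr (_, _); lia.
Qed.

(** Without the last row hexagon, a pyrene chain has no conflict with the row
    hexagon that comes next; this is the second state of the recurrence. *)
Definition open_pyrene_chain (n : nat) : {fset cell} :=
  pyrene_chain n `\ (n.*2%:Z - 1, 0).

Definition in_cells :=
  (in_fset_sep, in_fset0, in_fset1U, in_fsetD1, in_pyrene_chain, xpair_eqE).

Lemma pyrene_chainS (n : nat) :
  pyrene_chain n.+1 = (n.*2%:Z + 1, 0) |` open_pyrene_chain n.+1.
Proof.
apply/fsetP => -[i j]; rewrite /open_pyrene_chain !in_cells /=.
lia.
Qed.

Lemma open_pyrene_chainS (n : nat) :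
  open_pyrene_chain n.+1 =
  (n.*2%:Z, 0) |` ((n.*2%:Z, 1) |` ((n.*2%:Z + 1, -1) |` pyrene_chain n)).
Proof.
apply/fsetP => -[i j]; rewrite /open_pyrene_chain !in_cells /=.
lia.
Qed.

Section Recurrence.

Variable R : comNzRingType.
Let P n : {poly R} := independence_poly overlap R (pyrene_chain n).
Let Q n : {poly R} := independence_poly overlap R (open_pyrene_chain n).

(** The rightmost hexagon of the row overlaps exactly the three other hexagons
    of its unit, so those compatible with it form the shorter chain. *)
Lemma pyrene_poly_right n : P n.+1 = Q n.+1 + 'X * P n.
Proof.
rewrite /P pyrene_chainS independence_poly_delete; first last.
- by rewrite /open_pyrene_chain !in_cells /=; lia.
- exact: overlap_sym.
congr (_ + 'X * _); congr (independence_poly _ _ _); apply/fsetP => -[i j].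
by rewrite /open_pyrene_chain !in_cells /overlap /=; lia.
Qed.

(** Once the right row hexagon is gone, the left one overlaps the upper and
    lower hexagons of its unit and the right row hexagon of the previous unit.
    Once both row hexagons are gone, the upper and the lower are isolated. *)
Lemma pyrene_poly_left n : Q n.+1 = (1 + 'X) ^+ 2 * P n + 'X * Q n.
Proof.
have del c H : c \notin H -> _ :=
  independence_poly_delete R overlap_sym (c := c) (H := H).
rewrite /Q open_pyrene_chainS del; last first.
  by rewrite /open_pyrene_chain !in_cells /=; lia.
congr (_ + 'X * _); last first.
  congr (independence_poly _ _ _); apply/fsetP => -[i j].
  by rewrite /open_pyrene_chain !in_cells /overlap /=; lia.
have isolated c H : c \notin H -> (forall d, d \in H -> ~~ overlap c d) ->
    independence_poly overlap R (c |` H) =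
    (1 + 'X) * independence_poly overlap R H.
  move=> cH noc; rewrite del // mulrDl mul1r; congr (_ + 'X * _).
  congr (independence_poly _ _ _); apply/fsetP => d.
  by rewrite in_fset_sep; apply: andb_idr; apply: noc.
rewrite !isolated ?expr2 ?mulrA //.
- by rewrite /open_pyrene_chain !in_cells /=; lia.
- by move=> [i j]; rewrite !in_cells /overlap /=; lia.
- by rewrite /open_pyrene_chain !in_cells /=; lia.
- move=> [i j]; rewrite /open_pyrene_chain !in_cells /overlap /=; lia.
Qed.

Lemma pyrene_poly0 : P 0 = 1.
Proof.
rewrite /P (_ : pyrene_chain 0 = fset0) ?independence_poly0 //.
by apply/fsetP => -[i j]; rewrite !in_cells /=; lia.
Qed.

Lemma pyrene_poly1 : P 1 = unit_quadratic 4.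
Proof.
rewrite pyrene_poly_right pyrene_poly_left pyrene_poly0.
rewrite /Q (_ : open_pyrene_chain 0 = fset0) ?independence_poly0.
  by rewrite /unit_quadratic -mul_polyC (_ : 4%:P = 4) ?polyC_natr //; ring.
by apply/fsetP => -[i j]; rewrite /open_pyrene_chain !in_cells /=; lia.
Qed.

Lemma pyrene_polySS n : P n.+2 = unit_quadratic 4 * P n.+1 - 'X ^+ 2 * P n.
Proof.
rewrite [LHS]pyrene_poly_right pyrene_poly_left.
have -> : Q n.+1 = P n.+1 - 'X * P n by rewrite pyrene_poly_right addrK.
rewrite /unit_quadratic -mul_polyC (_ : 4%:P = 4) ?polyC_natr //; ring.
Qed.

End Recurrence.

(** * Matching the uncovered vertices *)

Lemma horizontal_edge (c : cell) (x y : int) :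
  (x, y) \in corners c -> (x + 1, y) \in corners c ->
  [fset (x, y); (x + 1, y)] \in hexagon_edges c.
Proof.
move=> p1 p2; have e k := @hexagon_edge_nth c k.
case: c => i j in p1 p2 e *; move: p1 p2; rewrite !in_corners /= => p1 p2.
have := e 0%N isT; have := e 1%N isT; have := e 3%N isT; have := e 4%N isT.
rewrite /= !mulr2n => e4 e3 e1 e0.
have [y0|y0] := eqVneq y j; have [x0|x0] := eqVneq x (i + i + j); subst.
- exact: e0.
- have -> : x = i + i + j + 1 by lia.
  by rewrite (_ : _ + 1 + 1 = i + i + j + 2); [exact: e1 | lia].
- have -> : y = j + 1 by lia.
  by rewrite fsetUC; exact: e4.
- have -> : x = i + i + j + 1 by lia.
  have -> : y = j + 1 by lia.
  by rewrite (_ : _ + 1 + 1 = i + i + j + 2) 1?fsetUC; [exact: e3 | lia].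
Qed.

Lemma vertical_edge (c : cell) (x y : int) :
  (x, y) \in corners c -> (x, y + 1) \in corners c -> x != c.1 * 2 + c.2 + 1 ->
  [fset (x, y); (x, y + 1)] \in hexagon_edges c.
Proof.
move=> p1 p2; have e k := @hexagon_edge_nth c k.
case: c => i j in p1 p2 e *; move: p1 p2; rewrite !in_corners /= => p1 p2 xm.
have := e 2%N isT; have := e 5%N isT.
rewrite /= !mulr2n => e5 e2.
have -> : y = j by lia.
have [->|x0] := eqVneq x (i + i + j); first by rewrite fsetUC.
have -> : x = i + i + j + 2 by lia.
exact: e2.
Qed.

(** The vertices form two long rows y = 0, 1 and two outer rows y = 2, -1 that
    are interrupted at the columns x = 0 mod 4, the borders between units. *)
Lemma in_vertices_pyrene n (p : point) :
  (p \in vertices (pyrene_chain n.+1)) =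
  (0 <= p.1 <= n.+1%:Z * 4) &&
  ((0 <= p.2 <= 1) || ((p.1 %% 4)%Z != 0) && ((p.2 == 2) || (p.2 == -1))).
Proof.
case: p => x y; apply/verticesP/idP => [[[i j]]|/= /andP[x0 /orP[y0|/andP[x4 /orP[]/eqP->]]]].
- rewrite in_pyrene_chain in_corners /= => cH pc; lia.
- exists (if x == n.+1%:Z * 4 then n.*2%:Z + 1 else (x %/ 2)%Z, 0);
    rewrite ?in_pyrene_chain ?in_corners /=; case: eqP; lia.
- by exists ((x %/ 4)%Z * 2, 1); rewrite ?in_pyrene_chain ?in_corners /=; lia.
- by exists ((x %/ 4)%Z * 2 + 1, -1); rewrite ?in_pyrene_chain ?in_corners /=; lia.
Qed.

(** The left row hexagon of the unit that contains the column x. *)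
Definition left_hexagon (x : int) : cell := ((x %/ 4)%Z * 2, 0).

(** Exchanges the rows 1 and 2, and the rows 0 and -1. *)
Definition outer_swap (y : int) : int := if 1 <= y then 3 - y else -1 - y.

(** The border columns are matched vertically.  In a unit, if the left row
    hexagon is in S, it covers the border column to its left, and the outer path
    left by it is matched as columns 1-2 and vertically in column 3.  Otherwise
    column 1 is matched vertically and columns 2-3 horizontally: this matches
    the boundaries of the upper and of the lower hexagon within themselves, and
    also agrees with the right row hexagon, whose vertices off the border are
    those of the inner rows in columns 2-3.  So only one
    bit of S per unit matters. *)
Definition partner (S : {fset cell}) (p : point) : point :=
  let: (x, y) := p in
  let r := (x %% 4)%Z in
  if r == 0 then (x, 1 - y)
  else if left_hexagon x \in S then
    if r == 1 then (x + 1, y) else if r == 2 then (x - 1, y)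
    else (x, outer_swap y)
  else
    if r == 1 then (x, outer_swap y) else if r == 2 then (x + 1, y)
    else (x - 1, y).

Arguments partner : simpl never.

Lemma partnerE S x y : partner S (x, y) =
  let r := (x %% 4)%Z in
  if r == 0 then (x, 1 - y)
  else if left_hexagon x \in S then
    if r == 1 then (x + 1, y) else if r == 2 then (x - 1, y)
    else (x, outer_swap y)
  else
    if r == 1 then (x, outer_swap y) else if r == 2 then (x + 1, y)
    else (x - 1, y).
Proof. by []. Qed.

Section Partner.

Variables (n : nat) (S : {fset cell}).
Let H := pyrene_chain n.+1.
Hypothesis SH : S `<=` H.
Hypothesis indS : independent overlap S.

Lemma partner_vertex p : p \in vertices H -> partner S p \in vertices H.
Proof.
case: p => x y; rewrite !in_vertices_pyrene partnerE /outer_swap /=.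
by do !case: ifP => /=; lia.
Qed.

Lemma left_hexagon_eq x x' : (x %/ 4)%Z = (x' %/ 4)%Z ->
  left_hexagon x = left_hexagon x'.
Proof. by rewrite /left_hexagon => ->. Qed.

Lemma partnerK p : p \in vertices H -> partner S (partner S p) = p.
Proof.
case: p => x y; rewrite in_vertices_pyrene /= => xy.
have outerK : (x %% 4)%Z != 0 -> outer_swap (outer_swap y) = y.
  by rewrite /outer_swap; do !case: ifP; lia.
rewrite [partner S (x, y)]partnerE /=; case: ifP => r0.
  by rewrite partnerE /= r0 subKr.
case: ifP => L; case: ifP => r1.
- rewrite partnerE /= (@left_hexagon_eq (x + 1) x) ?L; last lia.
  have -> : ((x + 1) %% 4)%Z = 2 by lia.
  by rewrite /= addrK.
- case: ifP => r2; last by rewrite partnerE /= r0 L r1 r2 outerK ?r0.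
  rewrite partnerE /= (@left_hexagon_eq (x - 1) x) ?L; last lia.
  have -> : ((x - 1) %% 4)%Z = 1 by lia.
  by rewrite /= subrK.
- by rewrite partnerE /= r0 L r1 outerK ?r0.
case: ifP => r2.
- rewrite partnerE /= (@left_hexagon_eq (x + 1) x) ?L; last lia.
  have -> : ((x + 1) %% 4)%Z = 3 by lia.
  by rewrite /= addrK.
- rewrite partnerE /= (@left_hexagon_eq (x - 1) x) ?L; last lia.
  have -> : ((x - 1) %% 4)%Z = 2 by lia.
  by rewrite /= subrK.
Qed.

(** Each hexagon of S is a union of matched pairs.  When the left row hexagon of
    a unit is not in S, this holds for every other hexagon of the unit; when it
    is in S, independence leaves no other hexagon in that unit. *)
Lemma partner_covered p : p \in vertices H ->
  partner S p \in vertices S -> p \in vertices S.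
Proof.
move=> pH /verticesP[c cS pc]; apply/verticesP; exists c => //.
have := fsubsetP SH c cS; rewrite in_pyrene_chain.
have noL x : left_hexagon x \in S ->
    left_hexagon x = c \/ ~~ overlap (left_hexagon x) c.
  move=> LS; case: (boolP (overlap _ _)) => ov; [left|by right].
  exact: (independentP _ _ indS).
have neL x : left_hexagon x \notin S -> left_hexagon x != c.
  by apply: contraNneq => ->.
case: c p {cS} pH pc noL neL => i j [x y]; rewrite in_vertices_pyrene.
rewrite partnerE /outer_swap => pH pc /(_ x) noL /(_ x) neL; move: pH pc.
rewrite [left_hexagon x == _]/eq_op /= in neL.
case: ifP => r0; first by rewrite !in_corners /=; lia.
case: ifP => L.
  case: (noL L) => [[eqi eqj]|]; do !case: ifP; rewrite /overlap !in_corners /=; lia.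
have {}neL := neL (negbT L).
do !case: ifP; rewrite !in_corners /=; lia.
Qed.

Lemma partner_edge p : p \in vertices H -> [fset p; partner S p] \in edges H.
Proof.
have edgeH c e : c \in H -> e \in hexagon_edges c -> e \in edges H.
  by move=> cH ec; apply/edgesP; exists c.
have horH c x y : c \in H -> (x, y) \in corners c -> (x + 1, y) \in corners c ->
    [fset (x, y); (x + 1, y)] \in edges H.
  by move=> cH p1 p2; apply: (edgeH c) => //; apply: horizontal_edge.
have verH c x y : c \in H -> (x, y) \in corners c -> (x, y + 1) \in corners c ->
    x != c.1 * 2 + c.2 + 1 -> [fset (x, y); (x, y + 1)] \in edges H.
  by move=> cH p1 p2 xm; apply: (edgeH c) => //; apply: vertical_edge.
case: p => x y; rewrite in_vertices_pyrene /= => xy.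
have hor z : 0 <= z <= n.+1%:Z * 4 -> ((z %% 4)%Z == 1) || ((z %% 4)%Z == 2) ->
    [fset (z, y); (z + 1, y)] \in edges H.
  (* Outer rows lie on the upper or the lower hexagon; in the inner rows,
     columns 1-2 lie on the left row hexagon and columns 2-3 on the right. *)
  move=> zn z12.
  apply: (horH ((z %/ 4)%Z * 2 +
      (if y == 2 then 0 else if y == -1 then 1 else (z %% 4)%Z - 1),
    (if y == 2 then 1 else if y == -1 then -1 else 0))).
  - by rewrite in_pyrene_chain /=; do !case: ifP; lia.
  - by rewrite in_corners /=; do !case: ifP; lia.
  - by rewrite in_corners /=; do !case: ifP; lia.
have out : ((x %% 4)%Z == 1) || ((x %% 4)%Z == 3) ->
    [fset (x, y); (x, outer_swap y)] \in edges H.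
  move=> r13; pose c := (((x %/ 4)%Z * 2, 1) : cell).
  pose d := (((x %/ 4)%Z * 2 + 1, -1) : cell).
  have cH : c \in H by rewrite in_pyrene_chain /=; lia.
  have dH : d \in H by rewrite in_pyrene_chain /=; lia.
  have up : [fset (x, 1); (x, 2)] \in edges H.
    by apply: (verH c x 1); rewrite ?in_corners //=; lia.
  have down : [fset (x, -1); (x, 0)] \in edges H.
    by apply: (verH d x (-1)); rewrite ?in_corners //=; lia.
  have : y \in [:: 2; 1; 0; -1] by rewrite !inE; lia.
  by rewrite !inE /outer_swap => /or4P[] /eqP-> //=; rewrite fsetUC.
have [r0|r0] := eqVneq (x %% 4)%Z 0.
  rewrite partnerE /= r0 /=.
  (* The last border column is not the left side of a hexagon of H. *)
  have mid : [fset (x, 0); (x, 1)] \in edges H.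
    apply: (verH (if x == n.+1%:Z * 4 then n.*2%:Z + 1 else (x %/ 2)%Z, 0) x 0).
    - by rewrite in_pyrene_chain /=; case: ifP; lia.
    - by rewrite in_corners /=; case: ifP; lia.
    - by rewrite in_corners /=; case: ifP; lia.
    - by rewrite /=; case: ifP; lia.
  have : y \in [:: 0; 1] by rewrite !inE; lia.
  by rewrite !inE => /orP[] /eqP-> //=; rewrite fsetUC.
have prev : ((x %% 4)%Z == 2) || ((x %% 4)%Z == 3) ->
    [fset (x, y); (x - 1, y)] \in edges H.
  by move=> r23; have := hor (x - 1); rewrite subrK fsetUC; apply; lia.
rewrite partnerE /= (negPf r0).
by do !case: ifP => ?; [apply: hor | apply: prev | apply: out
  | apply: out | apply: hor | apply: prev]; lia.
Qed.

Lemma independent_resonant_pattern : S \in resonant_patterns H.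
Proof.
apply: (@disjoint_resonant_pattern _ _ (partner S)) => //.
  exact/independent_disjoint.
move=> p; rewrite in_fsetD => /andP[pS pH]; split.
- rewrite in_fsetD partner_vertex // andbT.
  by apply: contra pS; apply: partner_covered.
- exact: partnerK.
- exact: partner_edge.
Qed.

End Partner.

Lemma resonant_patterns_pyrene n (S : {fset cell}) :
  (S \in resonant_patterns (pyrene_chain n.+1)) =
  (S `<=` pyrene_chain n.+1) && independent overlap S.
Proof.
apply/idP/andP => [/resonant_pattern_disjoint[SH /independent_disjoint] //|[]].
exact: independent_resonant_pattern.
Qed.

(** * Coefficients of the sextet polynomial *)

(** The truncation at the Clar number loses nothing, as it bounds the size of
    every resonant pattern. *)
Lemma coef_sextet_poly (H : {fset cell}) k :
  (sextet_poly H)`_k = num_resonant H k.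
Proof.
rewrite coef_poly; case: ltnP => // lt; apply/esym/eqP.
rewrite cardfs_eq0; apply/eqP/fsetP => S; rewrite in_fset_sep in_fset0.
apply/negP => /andP[SR /eqP Sk]; move: lt; rewrite ltnNge -Sk.
by rewrite /clar_number (big_fsetD1 S) //= leq_maxl.
Qed.

Lemma sextet_poly_pyrene (R : comNzRingType) n :
  map_poly (fun m => m%:R : R) (sextet_poly (pyrene_chain n.+1)) =
  independence_poly overlap R (pyrene_chain n.+1).
Proof.
apply/polyP => k; rewrite coef_map_id0 // coef_sextet_poly /independence_poly.
rewrite coef_sum /num_resonant card_fset_sum1 natr_sum big_fset /= big_mkcond.
rewrite [RHS]big_fset_condE; apply: eq_fbig => [S|S _].
  by rewrite resonant_patterns_pyrene in_fset_sep fpowersetE.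
by rewrite coefXn eq_sym; case: eqP.
Qed.

Lemma sextet_poly_pyrene_coefs n
    (a := nth 0%N (sextet_poly (pyrene_chain n.+1))) :
  [/\ size (sextet_poly (pyrene_chain n.+1)) = n.+1.*2.+1,
      forall i j, (i + j)%N = n.+1.*2 -> a i = a j &
      forall i j, (i <= j)%N -> (a i * a j.+2 <= a i.+1 * a j.+1)%N].
Proof.
have [s [sn s2] PE] := recurrence_factorization
  (pyrene_poly0 algC) (pyrene_poly1 algC) (pyrene_polySS algC) n.+1.
have [_ sizeP [_ symP] [_ lcP]] := unit_quadratic_prod s2.
rewrite -PE -sextet_poly_pyrene sn in sizeP symP lcP.
set p := sextet_poly _ in a sizeP symP lcP *.
have coefE k : (map_poly (fun m => m%:R : algC) p)`_k = (a k)%:R.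
  exact: coef_map_id0.
split.
- rewrite -sizeP size_map_inj_poly // => i j /eqP.
  by rewrite eqr_nat => /eqP.
- by move=> i j /symP/eqP; rewrite !coefE eqr_nat => /eqP.
- by move=> i j /lcP; rewrite /= !coefE -!natrM ler_nat.
Qed.

Local Close Scope ring_scope.
Local Close Scope fset_scope.

Theorem theorem2p8 (n : nat) (hn : 0 < n) :
  [/\ symmetric_seq (sextet_poly (pyrene_chain n)),
      unimodal_seq (sextet_poly (pyrene_chain n)) &
      log_concave_seq (sextet_poly (pyrene_chain n))].
Proof.
case: n hn => // n _.
have [] := sextet_poly_pyrene_coefs n; set p := sextet_poly _.
set a := nth 0 p => size_p sym lc.
have up k : k < n.+1 -> a k <= a k.+1.
  (* Log-concavity between k and its mirror image n.+1.*2 - k. *)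
  move=> kn; have := lc k (n.+1.*2 - k).-2.
  rewrite (sym (n.+1.*2 - k).-2.+2 k); last lia.
  rewrite (sym (n.+1.*2 - k).-2.+1 k.+1); last lia.
  by rewrite !mulnn leq_sqr; apply; lia.
split.
- by move=> k; rewrite size_p => kn; apply: sym; rewrite /=; lia.
- exists n.+1; rewrite size_p; first lia.
  split=> // k nk kn; rewrite -/a (sym k.+1 (n.+1.*2 - k.+1)); last lia.
  rewrite (sym k (n.+1.*2 - k.+1).+1); last lia.
  by apply: up; lia.
- by move=> [|k] // _ kn; rewrite expnS expn1; apply: lc.
Qed.
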